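(* Assume that splay trees have the regular access property: there is a constant $k$ such that, for every initial tree, if $c_1+\cdots+c_m$ is the total cost of a sequence of $m$ splay operations and $c'_1+\cdots+c'_{m+e}$ is the cost of performing the same sequence of splay operations augmented with $e$ extra splays inserted anywhere, then $c_1+\cdots+c_m\le k\,(c'_1+\cdots+c'_{m+e})$. Consider a sequence of $m$ queries to a splay tree $S$ with $n+2$ keys, and suppose that a similar optimal binary search tree $T$ (in the cursor model) processes the same query sequence using $R$ rotations and $M$ cursor movements. Then the total number of operations performed by $S$ is $O(n+R+M)$.
   Context: Cursor model of binary search trees: there is a cursor at a node; allowed operations are comparing the key at the cursor with the searched value (cost $0$), moving the cursor to the left child, right child or parent (cost $1$), and rotating the node at the cursor upwards (cost $1$); a search starts with the cursor at the root, must compare equal with the searched key at some point, and must return the cursor to the root at the end; each node may hold a constant amount of extra information. The optimal tree $T$ is chosen offline, knowing the whole query sequence. All queries are successful (for keys present in the tree). The splay tree $S$ answers each query for key $x$ by splaying $x$: repeatedly applying Zig (if the parent of $x$ is the root, rotate $x$ over it), ZigZig (if $x$ and its parent are both left or both right children, rotate the parent over the grandparent then $x$ over its parent) or ZigZag (otherwise rotate $x$ twice) until $x$ is the root; the cost of a splay is the number of cursor moves, i.e., the depth of $x$ in $S$. ''Similar'' means that $S$ and the tree used for comparison start from the same initial configuration; the $n+2$ keys of $S$ consist of the $n$ keys of $T$ together with two extra keys, one smaller and one larger than all others. *)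

(* Defs.v *)
From mathcomp Require Import all_boot.
Set Implicit Arguments. Unset Strict Implicit. Unset Printing Implicit Defensive.

Inductive tree := Leaf | Node of tree & nat & tree.

Fixpoint keys (t : tree) : seq nat :=
  match t with Leaf => [::] | Node l k r => keys l ++ k :: keys r end.
Definition bst (t : tree) : bool := sorted ltn (keys t).

(** Zipper frames: [FL k r] = we went to the left child of the node with key
    [k] and right subtree [r]; [FR l k] = we went to the right child of the
    node with left subtree [l] and key [k]. The head of a frame list is the
    parent of the focus. *)
Inductive frame := FL of nat & tree | FR of tree & nat.

Fixpoint find_path (x : nat) (t : tree) (fs : seq frame)
  : option (tree * nat * tree * seq frame) :=
  match t with
  | Leaf => None
  | Node l k r =>
      if x == k then Some (l, k, r, fs)
      else if x < k then find_path x l (FL k r :: fs)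
      else find_path x r (FR l k :: fs)
  end.

(** Bottom-up splaying of the node [Node a x b] whose ancestors are [fs]
    (nearest first): ZigZig / ZigZag while there is a grandparent, then a
    final Zig if the parent is the root. *)
Fixpoint splay_up (a : tree) (x : nat) (b : tree) (fs : seq frame) : tree :=
  match fs with
  | [::] => Node a x b
  | [:: FL p c] => Node a x (Node b p c)
  | [:: FR c p] => Node (Node c p a) x b
  | FL p c :: FL g d :: rest => splay_up a x (Node b p (Node c g d)) rest
  | FR c p :: FR d g :: rest => splay_up (Node (Node d g c) p a) x b rest
  | FR c p :: FL g d :: rest => splay_up (Node c p a) x (Node b g d) rest
  | FL p c :: FR d g :: rest => splay_up (Node d g a) x (Node b p c) rest
  end.

Definition splay (x : nat) (t : tree) : tree :=
  match find_path x t [::] with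
  | Some (a, k, b, fs) => splay_up a k b fs
  | None => t
  end.

Definition splay_cost (x : nat) (t : tree) : nat :=
  match find_path x t [::] with
  | Some (_, _, _, fs) => size fs
  | None => 0
  end.

Fixpoint splay_seq_cost (t : tree) (s : seq nat) : nat :=
  match s with
  | [::] => 0
  | x :: s' => splay_cost x t + splay_seq_cost (splay x t) s'
  end.

Definition regular_access_property : Prop :=
  exists k : nat, forall (t : tree) (s s' : seq nat),
    bst t -> all (fun x => x \in keys t) s' -> subseq s s' ->
    splay_seq_cost t s <= k * splay_seq_cost t s'.

Inductive op := MoveLeft | MoveRight | MoveParent | RotateUp.

(** A cursor state: the subtree at the cursor together with its ancestors. *)
Definition cstate := (tree * seq frame)%type.

Definition step (o : op) (z : cstate) : option cstate :=
  let: (t, fs) := z in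
  match o with
  | MoveLeft =>
      match t with Node (Node _ _ _ as l) k r => Some (l, FL k r :: fs) | _ => None end
  | MoveRight =>
      match t with Node l k (Node _ _ _ as r) => Some (r, FR l k :: fs) | _ => None end
  | MoveParent =>
      match fs with
      | [::] => None
      | FL k r :: fs' => Some (Node t k r, fs')
      | FR l k :: fs' => Some (Node l k t, fs')
      end
  | RotateUp =>
      match t, fs with
      | Node a x b, FL p c :: fs' => Some (Node a x (Node b p c), fs')
      | Node a x b, FR c p :: fs' => Some (Node (Node c p a) x b, fs')
      | _, _ => None
      end
  end.

Fixpoint exec (z : cstate) (ops : seq op) : option (seq cstate) :=
  match ops with
  | [::] => Some [::]
  | o :: ops' =>
      match step o z with
      | None => None
      | Some z' => omap (cons z') (exec z' ops')
      end
  end.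

Definition focus_key (z : cstate) : option nat :=
  if z.1 is Node _ k _ then Some k else None.

Definition query_step (x : nat) (t : tree) (ops : seq op) : option tree :=
  match exec (t, [::]) ops with
  | None => None
  | Some st =>
      let zl := last (t, [::]) st in
      if zl.2 is [::] then
        if has (fun z => focus_key z == Some x) ((t, [::]) :: st) then Some zl.1
        else None
      else None
  end.

Fixpoint run_exec (t : tree) (qs : seq nat) (ex : seq (seq op)) : option tree :=
  match qs, ex with
  | [::], [::] => Some t
  | x :: qs', ops :: ex' =>
      match query_step x t ops with
      | Some t' => run_exec t' qs' ex'
      | None => None
      end
  | _, _ => None
  end.

Definition valid_exec (t : tree) (qs : seq nat) (ex : seq (seq op)) : bool :=
  isSome (run_exec t qs ex).

Definition is_rot (o : op) : bool := if o is RotateUp then true else false.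
Definition rotations (ex : seq (seq op)) : nat := count is_rot (flatten ex).
Definition moves (ex : seq (seq op)) : nat := count (fun o => ~~ is_rot o) (flatten ex).

Definition optimal_exec (t : tree) (qs : seq nat) (ex : seq (seq op)) : Prop :=
  valid_exec t qs ex /\
  forall ex', valid_exec t qs ex' ->
    rotations ex + moves ex <= rotations ex' + moves ex'.

(** Standard BST leaf insertion (used to add the two sentinel keys). *)
Fixpoint bst_insert (x : nat) (t : tree) : tree :=
  match t with
  | Leaf => Node Leaf x Leaf
  | Node l k r => if x < k then Node (bst_insert x l) k r else Node l k (bst_insert x r)
  end.

(* Main.v *)
(* A splay tree can simulate a cursor tree at constant cost per operation: keep
   the node at the cursor at the root, and its smaller (larger) ancestors on a
   spine below the left (right) child of the root, ended by the small (large)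
   sentinel. Moving the cursor down is then one ZigZag splay, while moving up or
   rotating is a sequence of three splays touching only the four nodes at the
   top. A query comes when the key is at the root, where splaying it is free.
   Linearly many splays and simulated cursor operations bring the initial splay
   tree into this form. The queries are thus a subsequence of a splay sequence of
   cost O(n + R + M), and the regular access property concludes. *)
Require Import Defs.
From mathcomp Require Import all_boot.

Set Implicit Arguments. Unset Strict Implicit. Unset Printing Implicit Defensive.

(** * Zippers, key order and a single splay *)

Fixpoint plug (t : tree) (fs : seq frame) : tree :=
  match fs with
  | [::] => t
  | FL k r :: fs' => plug (Node t k r) fs'
  | FR l k :: fs' => plug (Node l k t) fs'
  end.

Lemma eq_keys_plug t t' fs : keys t = keys t' -> keys (plug t fs) = keys (plug t' fs).
Proof. by elim: fs t t' => [|[k r|l k] fs IH] t t' //= e; apply: IH; rewrite /= e. Qed.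

(** [splay_up] consumes two frames per step, hence the induction on a bound for their number. *)
Lemma keys_splay_up a x b fs : keys (splay_up a x b fs) = keys (plug (Node a x b) fs).
Proof.
have [n] := ubnP (size fs); elim: n fs a b => // n IH [|f [|g fs]] a b /=.
- by [].
- by case: f => [p c|c p] _ //=; rewrite -!catA.
- by case: f g => [p c|c p] [g d|d g] /= /ltnW lt_n; rewrite IH //;
    apply: eq_keys_plug; rewrite /= -!catA /= -?catA.
Qed.

Lemma splay_up_root a x b fs : exists a' b', splay_up a x b fs = Node a' x b'.
Proof.
have [n] := ubnP (size fs); elim: n fs a b => // n IH [|f [|g fs]] a b /=.
- by exists a, b.
- by case: f => [p c|c p] _; do 2 eexists.
- by case: f g => [p c|c p] [g d|d g] /= /ltnW lt_n; apply: IH.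
Qed.

(** The suffix [fs] of [gs] later shows that an access path to the right of the root ends in the
    root's frame. *)
Lemma find_path_sound x t fs a k b gs : find_path x t fs = Some (a, k, b, gs) ->
  [/\ k = x, plug (Node a k b) gs = plug t fs, size gs <= size fs + size (keys t)
    & exists hs, gs = hs ++ fs].
Proof.
elim: t fs => //= l IHl k' r IHr fs; rewrite size_cat /=.
case: eqP => [-> [-> -> -> ->]|_]; first by split; rewrite ?leq_addr //; exists [::].
case: ifP => _.
- case/IHl=> -> -> /= le_gs [hs e]; split => //.
    by apply: leq_trans le_gs _; rewrite addSnnS leq_add2l addnS ltnS leq_addr.
  by exists (rcons hs (FL k' r)); rewrite e cat_rcons.
- case/IHr=> -> -> /= le_gs [hs e]; split => //.
    by apply: leq_trans le_gs _; rewrite addSnnS leq_add2l leq_addl.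
  by exists (rcons hs (FR l k')); rewrite e cat_rcons.
Qed.

Lemma bst_node l k r :
  bst (Node l k r) = [&& bst l, bst r, all (ltn^~ k) (keys l) & all (ltn k) (keys r)].
Proof.
rewrite /bst /= !(sorted_pairwise ltn_trans) pairwise_cat /= allrel_consr.
apply/idP/idP; first by case/and4P=> /andP[-> _] -> -> ->.
case/and4P=> -> -> ltl ltr; rewrite ltl ltr !andbT /=.
apply/allrelP => y z /(allP ltl) ltyk /(allP ltr); exact: ltn_trans.
Qed.

Lemma find_path_complete x t fs : bst t -> x \in keys t -> find_path x t fs <> None.
Proof.
elim: t fs => //= l IHl k r IHr fs; rewrite bst_node => /and4P[bl br ltl ltr].
rewrite mem_cat inE; case: eqP => //= _ /orP[xl|xr].
- by have -> : x < k := allP ltl _ xl; apply: IHl.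
- by have lt : k < x := allP ltr _ xr; rewrite ltnNge ltnW //=; apply: IHr.
Qed.

Lemma keys_splay x t : keys (splay x t) = keys t.
Proof.
rewrite /splay; case e: find_path => [[[[a k] b] gs]|] //.
by rewrite keys_splay_up; have [_ -> _ _] := find_path_sound e.
Qed.

Lemma splay_cost_le x t : splay_cost x t <= size (keys t).
Proof.
rewrite /splay_cost; case e: find_path => [[[[a k] b] gs]|] //.
by have [] := find_path_sound e.
Qed.

Lemma splay_root x t : bst t -> x \in keys t -> exists a b, splay x t = Node a x b.
Proof.
move=> bt /(find_path_complete (fs := [::]) bt).
rewrite /splay; case e: find_path => [[[[a k] b] gs]|] // _.
by have [-> _ _ _] := find_path_sound e; apply: splay_up_root.
Qed.

(** * Splay sequences containing given queries *)

(** Splays in [s] outside [qs] are the extra ones of the regular access property. *)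
Definition serves (t t' : tree) (qs : seq nat) (c : nat) : Prop :=
  exists s, [/\ all (fun x => x \in keys t) s, subseq qs s,
    foldl (fun u x => splay x u) t s = t' & splay_seq_cost t s <= c].

Lemma keys_foldl_splay t s : keys (foldl (fun u x => splay x u) t s) = keys t.
Proof. by elim: s t => //= x s IH t; rewrite IH keys_splay. Qed.

Lemma splay_seq_cost_cat t s1 s2 : splay_seq_cost t (s1 ++ s2) =
  splay_seq_cost t s1 + splay_seq_cost (foldl (fun u x => splay x u) t s1) s2.
Proof. by elim: s1 t => //= x s1 IH t; rewrite IH addnA. Qed.

Lemma serves_keys t t' qs c : serves t t' qs c -> keys t' = keys t.
Proof. by case=> s [_ _ <- _]; apply: keys_foldl_splay. Qed.

Lemma serves_bst t t' qs c : serves t t' qs c -> bst t -> bst t'.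
Proof. by rewrite /bst => /serves_keys ->. Qed.

Lemma serves_refl t c : serves t t [::] c.
Proof. by exists [::]. Qed.

Lemma serves_trans t1 t2 t3 qs1 qs2 c1 c2 :
  serves t1 t2 qs1 c1 -> serves t2 t3 qs2 c2 -> serves t1 t3 (qs1 ++ qs2) (c1 + c2).
Proof.
move=> h1; have ek := serves_keys h1; case: h1 => s1 [m1 q1 e1 le1] [s2 [m2 q2 e2 le2]].
exists (s1 ++ s2); split.
- by rewrite all_cat m1 /= -ek.
- exact: cat_subseq.
- by rewrite foldl_cat e1.
- by rewrite splay_seq_cost_cat e1 leq_add.
Qed.

Lemma serves_splay x t t' : x \in keys t -> splay x t = t' ->
  serves t t' [::] (size (keys t)).
Proof.
by move=> xt e; exists [:: x]; rewrite /= xt e addn0; split=> //; apply: splay_cost_le.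
Qed.

Lemma serves_root a x b : serves (Node a x b) (Node a x b) [:: x] 0.
Proof.
by exists [:: x]; rewrite /= /splay /splay_cost /= !eqxx mem_cat mem_head orbT; split.
Qed.

(** * Simulation of cursor operations by splays *)

(** A smaller ancestor passes its left subtree [l] on to the next smaller one, since in a search
    tree [l] holds the keys between the two. *)
Fixpoint left_spine (lo : nat) (fs : seq frame) (a : tree) : tree :=
  match fs with
  | [::] => Node Leaf lo a
  | FL _ _ :: fs' => left_spine lo fs' a
  | FR l k :: fs' => Node (left_spine lo fs' l) k a
  end.

Fixpoint right_spine (hi : nat) (fs : seq frame) (b : tree) : tree :=
  match fs with
  | [::] => Node b hi Leaf
  | FL k r :: fs' => Node b k (right_spine hi fs' r)
  | FR _ _ :: fs' => right_spine hi fs' b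
  end.

Definition sim (lo hi : nat) (z : cstate) : tree :=
  if z.1 is Node a x b then Node (left_spine lo z.2 a) x (right_spine hi z.2 b)
  else Leaf.

(** The sentinel guarantees a top node, and only its right child depends on [a], so a simulated step
    need not look deeper into the spine. *)
Lemma left_spine_node lo fs : exists A p, forall a, left_spine lo fs a = Node A p a.
Proof. by elim: fs => [|[k r|l k] fs IH] //=; do 2 eexists. Qed.

Lemma right_spine_node hi fs : exists q B, forall b, right_spine hi fs b = Node b q B.
Proof. by elim: fs => [|[k r|l k] fs IH] //=; do 2 eexists. Qed.

Lemma ltn_cmp m n : m < n ->
  ((m < n) = true) * ((m == n) = false) * ((n == m) = false) * ((n < m) = false).
Proof. by move=> lt; rewrite lt (ltn_eqF lt) (gtn_eqF lt) ltnNge ltnW. Qed.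

Ltac split_andb :=
  repeat match goal with H : is_true (_ && _) |- _ => case/andP: H => ? ? end.

(** Transitive closure lets the comparisons made by [find_path] on explicit nodes reduce to
    booleans. *)
Ltac close_ltn :=
  repeat match goal with
  H : is_true (?m < ?n), H' : is_true (?n < ?p) |- _ =>
    lazymatch goal with
    | _ : is_true (m < p) |- _ => fail
    | _ => have ? := ltn_trans H H'
    end
  end.

Ltac eval_splays := rewrite /splay /splay_cost /=;
  repeat (rewrite ?eqxx /=;
    match goal with H : is_true (_ < _) |- _ => rewrite !(ltn_cmp H) /= end).

Ltac serve_by bt s :=
  do ![rewrite (bst_node, all_cat) /= in bt]; split_andb; close_ltn;
  exists s; rewrite /= !(mem_cat, inE) !eqxx ?orbT; split=> //; eval_splays.

(* The splay sequences come from an exhaustive search on four-node trees. *)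
Lemma step_sim lo hi o z z' : focus_key z -> bst (sim lo hi z) -> step o z = Some z' ->
  serves (sim lo hi z) (sim lo hi z') [::] 8.
Proof.
case: z => [[|a x b] fs] // _; rewrite /sim /=.
have [A [p eP]] := left_spine_node lo fs; have [q [B eQ]] := right_spine_node hi fs.
case: o => /=.
- case: a => // a y a'; rewrite eP eQ => bt [<-] /=; rewrite eP eQ.
  (* [y] is a right child of a left child: one ZigZag splits its subtrees between [p] and [x]. *)
  by serve_by bt [:: y].
- case: b => // b y b'; rewrite eP eQ => bt [<-] /=; rewrite eP eQ.
  by serve_by bt [:: y].
- case: fs eP eQ => // -[k r|l k] fs /= eP eQ.
  + have {q B eQ}[q [B eQ]] := right_spine_node hi fs.
    rewrite eP eQ => bt [<-] /=; rewrite eP eQ.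
    (* Splaying [p] and [q] leaves [x] below [k] below [p] below [q]; a ZigZag on [k] then restores
       the form. The depths are 1, 3 and 2. *)
    by serve_by bt [:: p; q; k].
  + have {A p eP}[A [p eP]] := left_spine_node lo fs.
    rewrite eP eQ => bt [<-] /=; rewrite eP eQ.
    by serve_by bt [:: q; p; k].
- case: fs eP eQ => // -[k r|l k] fs /= eP eQ.
  + have {q B eQ}[q [B eQ]] := right_spine_node hi fs.
    rewrite eP eQ => bt [<-] /=; rewrite eP eQ.
    (* After the same two splays, raising [x] leaves [k] on top of [b] and [r], as the rotation
       does. The depths 1, 3 and 3 give 7, the largest cost of a step. *)
    by serve_by bt [:: p; q; x].
  + have {A p eP}[A [p eP]] := left_spine_node lo fs.
    rewrite eP eQ => bt [<-] /=; rewrite eP eQ.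
    by serve_by bt [:: q; p; x].
Qed.

Lemma step_focus o z z' : focus_key z -> step o z = Some z' -> focus_key z'.
Proof.
case: z => [[|a x b] fs] // _; case: o => /=.
- by case: a => // ? ? ? [<-].
- by case: b => // ? ? ? [<-].
- by case: fs => // -[? ?|? ?] fs [<-].
- by case: fs => // -[? ?|? ?] fs [<-].
Qed.

Lemma exec_sim lo hi z ops st : focus_key z -> bst (sim lo hi z) -> exec z ops = Some st ->
  focus_key (last z st) /\
  serves (sim lo hi z) (sim lo hi (last z st)) [::] (8 * size ops).
Proof.
elim: ops z st => [|o ops IH] z st fz bz /=; first by case=> <-; split=> //; apply: serves_refl.
case e: step => [z'|] //; case e': exec => [st'|] //= [<-] /=.
have h := step_sim fz bz e.
have [f' s'] := IH _ _ (step_focus fz e) (serves_bst h bz) e'.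
by split=> //; rewrite mulnS; exact: (serves_trans h s').
Qed.

Lemma serves_focus lo hi z x : focus_key z == Some x ->
  serves (sim lo hi z) (sim lo hi z) [:: x] 0.
Proof. by case: z => [[|a k b] fs] //= /eqP[->]; apply: serves_root. Qed.

(** The splay of [x] is inserted at the first state with key [x], where it is free. *)
Lemma exec_sim_query lo hi x z ops st : focus_key z -> bst (sim lo hi z) ->
  exec z ops = Some st -> has (fun z => focus_key z == Some x) (z :: st) ->
  serves (sim lo hi z) (sim lo hi (last z st)) [:: x] (8 * size ops).
Proof.
elim: ops z st => [|o ops IH] z st fz bz.
  by case=> <- /=; rewrite orbF; apply: serves_focus.
move=> e /orP[/(serves_focus lo hi) h|].
  by have [_ /(serves_trans h)] := exec_sim fz bz e.
move: e => /=; case e: step => [z'|] //; case e': exec => [st'|] //= [<-] hst.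
have h := step_sim fz bz e; rewrite /= mulnS; apply: (serves_trans h).
exact: IH (step_focus fz e) (serves_bst h bz) e' hst.
Qed.

Lemma run_exec_sim lo hi t qs ex t' : focus_key (t, [::]) -> bst (sim lo hi (t, [::])) ->
  run_exec t qs ex = Some t' ->
  serves (sim lo hi (t, [::])) (sim lo hi (t', [::])) qs (8 * size (flatten ex)).
Proof.
elim: qs t ex => [|x qs IH] t [|ops ex] // ft bt.
  by case=> <-; apply: serves_refl.
rewrite /= /query_step; case e: exec => [st|] //.
have [] := exec_sim ft bt e; have := exec_sim_query ft bt e (x := x).
case: (last _ _) => u [|f fs] //=; case: ifP => // _ /(_ isT) h fu _ e'.
rewrite size_cat mulnDr; apply: (serves_trans (qs1 := [:: x]) h).
exact: IH fu (serves_bst h bt) e'.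
Qed.

(** * Reshaping a tree by linearly many cursor operations *)

Inductive reach : cstate -> cstate -> nat -> Prop :=
| reach_refl z n : reach z z n
| reach_step z o z1 z2 n : step o z = Some z1 -> reach z1 z2 n -> reach z z2 n.+1.

Lemma reach_step1 o z z1 z2 n : step o z = Some z1 -> reach z1 z2 n -> reach z z2 (1 + n).
Proof. exact: reach_step. Qed.

Lemma reach_trans z1 z2 z3 m n : reach z1 z2 m -> reach z2 z3 n -> reach z1 z3 (m + n).
Proof.
elim=> {z1 z2 m} [z m h|z o z1 z2 m e _ IH /IH h]; last exact: reach_step e h.
elim: h m => [*|z1 o z2 z4 k e _ IH m]; first exact: reach_refl.
by rewrite addnS; apply: reach_step e _.
Qed.

(** A rotation is undone by moving to the former parent, rotating it up and moving back down, hence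
    3. *)
Lemma step_rev o z z' : focus_key z -> step o z = Some z' -> reach z' z 3.
Proof.
case: z => [[|a x b] fs] // _; case: o => /=.
- case: a => // ? ? ? [<-].
  by eapply (@reach_step _ MoveParent); [reflexivity | apply: reach_refl].
- case: b => // ? ? ? [<-].
  by eapply (@reach_step _ MoveParent); [reflexivity | apply: reach_refl].
- case: fs => // -[? ?|? ?] fs [<-].
  + by eapply (@reach_step _ MoveLeft); [reflexivity | apply: reach_refl].
  + by eapply (@reach_step _ MoveRight); [reflexivity | apply: reach_refl].
- case: fs => // -[? ?|? ?] fs [<-].
  + eapply (@reach_step _ MoveRight); [reflexivity |].
    eapply (@reach_step _ RotateUp); [reflexivity |].
    by eapply (@reach_step _ MoveLeft); [reflexivity | apply: reach_refl].
  + eapply (@reach_step _ MoveLeft); [reflexivity |].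
    eapply (@reach_step _ RotateUp); [reflexivity |].
    by eapply (@reach_step _ MoveRight); [reflexivity | apply: reach_refl].
Qed.

Lemma reach_sym z z' n : focus_key z -> reach z z' n -> reach z' z (n * 3).
Proof.
move=> fz h; elim: h fz => {z z' n} [z n _|z o z1 z2 n e _ IH fz]; first exact: reach_refl.
by rewrite mulSn addnC; apply: reach_trans (IH (step_focus fz e)) (step_rev fz e).
Qed.

Definition right_comb (ks : seq nat) (t : tree) : tree :=
  foldr (fun k => Node Leaf k) t ks.

(** Each key pays for the four operations outside the recursive calls: going left and rotating up,
    then visiting the right child and returning. *)
Lemma reach_comb_left t k s fs :
  reach (Node t k s, fs) (right_comb (keys t) (Node Leaf k s), fs) (4 * size (keys t)).
Proof.
rewrite /right_comb; elim: t k s fs => [|l IHl k0 r IHr] k s fs /=; first exact: reach_refl.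
rewrite foldr_cat size_cat /=.
have -> : 4 * (size (keys l) + (size (keys r)).+1) =
    1 + (1 + (1 + (4 * size (keys r) + (1 + 4 * size (keys l))))).
  by rewrite addnS mulnS mulnDr (addnC (4 * size (keys l))) !add1n addnS !addSn.
eapply (@reach_step1 MoveLeft); [reflexivity |].
eapply (@reach_step1 RotateUp); [reflexivity |].
eapply (@reach_step1 MoveRight); [reflexivity |].
apply: reach_trans (IHr _ _ _) _.
eapply (@reach_step1 MoveParent); [reflexivity |].
exact: IHl.
Qed.

Lemma reach_comb t fs : focus_key (t, fs) ->
  reach (t, fs) (right_comb (keys t) Leaf, fs) (4 * size (keys t)).
Proof.
elim: t fs => //= l _ k r IHr fs _.
rewrite /right_comb foldr_cat size_cat /=.
have h s := reach_comb_left l k s fs.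
case: r IHr => [|rl rk rr] IHr.
  by rewrite mulnDr; apply: reach_trans (h _) (reach_refl _ _).
(* The root key pays for going to the right child and back; the final [2] is slack. *)
have -> : forall n, 4 * (size (keys l) + n.+1) = 1 + (4 * n + (1 + (4 * size (keys l) + 2))).
  move=> n; rewrite addnS mulnS mulnDr (addnC (4 * size (keys l))) !add1n.
  by rewrite !addnS addn0 !addSn.
eapply (@reach_step1 MoveRight); [reflexivity |].
apply: reach_trans (IHr _ isT) _.
eapply (@reach_step1 MoveParent); [reflexivity |].
exact: reach_trans (h _) (reach_refl _ _).
Qed.

(** Both trees reach the same right comb; reversing the second path triples its length, so each key
    costs 4 + 12 = 16. *)
Lemma reach_same_keys t t' : focus_key (t, [::]) -> focus_key (t', [::]) ->
  keys t = keys t' -> reach (t, [::]) (t', [::]) (16 * size (keys t)).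
Proof.
move=> ft ft' e; have -> : 16 * size (keys t) = 4 * size (keys t) + 4 * size (keys t) * 3.
  by rewrite mulnAC -mulnDl.
apply: reach_trans (reach_comb ft) _; rewrite e.
by apply: reach_sym => //; apply: reach_comb.
Qed.

Lemma reach_sim lo hi z z' n : reach z z' n -> focus_key z -> bst (sim lo hi z) ->
  serves (sim lo hi z) (sim lo hi z') [::] (8 * n).
Proof.
elim=> {z z' n} [z n _ _|z o z1 z2 n e _ IH fz bz]; first exact: serves_refl.
have h := step_sim fz bz e; rewrite mulnS; apply: (serves_trans h).
exact: IH (step_focus fz e) (serves_bst h bz).
Qed.

(** * Bringing the sentinels into place *)

(** Only the last splay step touches the root: a Zig or ZigZag leaves [lo] at depth one, a ZigZig at
    depth two. *)
Lemma splay_up_right_of_root lo L fs a x b :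
  (exists X c, splay_up a x b (rcons fs (FR L lo)) = Node (Node L lo X) x c) \/
  (exists X p Y c,
    splay_up a x b (rcons fs (FR L lo)) = Node (Node (Node L lo X) p Y) x c).
Proof.
have [n] := ubnP (size fs); elim: n fs a b => // n IH [|f [|g fs]] a b /=.
- by left; do 2 eexists.
- by case: f => [p c|c p] _; [left | right]; do ?eexists.
- by case: f g => [p c|c p] [g d|d g] /= /ltnW lt_n; apply: IH.
Qed.

Lemma keys_insert_min x t : all (ltn x) (keys t) -> keys (bst_insert x t) = x :: keys t.
Proof.
elim: t => //= l IHl k r _; rewrite all_cat /= => /and3P[ltl lt _].
by rewrite lt /= IHl.
Qed.

Lemma keys_insert_max x t : all (ltn^~ x) (keys t) ->
  keys (bst_insert x t) = rcons (keys t) x.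
Proof.
elim: t => //= l _ k r IHr; rewrite all_cat /= => /and3P[_ lt ltr].
by rewrite ltnNge ltnW //= IHr // rcons_cat.
Qed.

(* Splaying both sentinels to the top leaves the smaller one at depth at most
   two; one or two further splays bring a node between them to the root. *)
Lemma serves_sentinels lo hi ks S : ks != [::] -> keys S = lo :: rcons ks hi -> bst S ->
  exists T, keys T = ks /\
    serves S (sim lo hi (T, [::])) [::] ((size ks).+2 + ((size ks).+2 + 8)).
Proof.
move=> nks eS bS.
have szS t : keys t = keys S -> size (keys t) = (size ks).+2.
  by rewrite eS => -> /=; rewrite size_rcons.
have loS : lo \in keys S by rewrite eS mem_head.
have hiS : hi \in keys S by rewrite eS inE mem_rcons mem_head orbT.
have bstS t : keys t = keys S -> bst t by rewrite /bst => ->.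
have ltlohi : lo < hi.
  move: bS; rewrite /bst eS (sorted_pairwise ltn_trans) /= => /andP[/allP h _].
  by apply: h; rewrite mem_rcons mem_head.
have [a [X e1]] := splay_root bS loS.
have k1 : keys (Node a lo X) = keys S by rewrite -e1 keys_splay.
have s1 := serves_splay loS e1; rewrite (szS S erefl) in s1.
have ea : a = Leaf.
  have := bstS _ k1; move: k1; rewrite bst_node eS => /= k1 /and4P[_ _ lta _].
  case: a {e1 s1} k1 lta => // l y r /=.
  by case: (keys l) => [|z s] /= [-> _]; rewrite ltnn.
subst a; have hi1 : hi \in keys (Node Leaf lo X) by rewrite k1.
have := find_path_complete (fs := [::]) (bstS _ k1) hi1.
rewrite /= !(ltn_cmp ltlohi); case ep: find_path => [[[[a y] b] gs]|] // _.
have [ey _ _ [fs egs]] := find_path_sound ep; subst y gs.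
have e2 : splay hi (Node Leaf lo X) = splay_up a hi b (rcons fs (FR Leaf lo)).
  by rewrite /splay /= !(ltn_cmp ltlohi) ep cats1.
have s2 := serves_splay hi1 e2; rewrite (szS _ k1) in s2.
have k2 : keys (splay_up a hi b (rcons fs (FR Leaf lo))) = keys S by rewrite -e2 keys_splay.
(* [hi] is the last key, so a nonempty right subtree would itself end in [hi]. *)
have rightLeaf Y c : keys (Node Y hi c) = keys S -> c = Leaf.
  move=> k; have := bstS _ k; move: k; rewrite eS bst_node => /= k /and4P[_ _ _ gtc].
  case: c k gtc => // l y r /=; rewrite -rcons_cons => /(congr1 (last lo)).
  rewrite last_rcons last_cat /= last_cat /= => eh /allP /(_ hi); rewrite -{1}eh.
  by rewrite mem_cat mem_last orbT /= ltnn => /(_ isT).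
case: (splay_up_right_of_root lo Leaf fs a hi b) => [[Y [c e]]|[Y [p [Z [c e]]]]];
  rewrite {}e in s2 k2; have ec := rightLeaf _ _ k2; subst c.
- have eY : keys Y = ks.
    by move: k2; rewrite eS /= cats1 => -[] /rcons_inj[].
  case: Y eY k2 s2 => [e0|l p r eY k2 s2]; first by rewrite -e0 in nks.
  exists (Node l p r); split=> //.
  apply: (serves_trans s1); apply: (serves_trans s2).
  by have bt := bstS _ k2; serve_by bt [:: p].
- exists (Node Y p Z); split.
    by move: k2; rewrite eS /= cats1 => -[] /rcons_inj[].
  apply: (serves_trans s1); apply: (serves_trans s2).
  (* A ZigZig on [lo] puts [p] directly below the root; a Zig on [p] then separates the
     sentinels. *)
  by have bt := bstS _ k2; serve_by bt [:: lo; p].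
Qed.

Theorem theorem4p6 :
  regular_access_property ->
  exists C : nat,
    forall (T0 : tree) (lo hi : nat) (qs : seq nat) (ex : seq (seq op)),
      bst T0 ->
      lo < hi ->
      all (fun y => lo < y < hi) (keys T0) ->
      all (fun x => x \in keys T0) qs ->
      optimal_exec T0 qs ex ->
      splay_seq_cost (bst_insert hi (bst_insert lo T0)) qs
        <= C * (size (keys T0) + rotations ex + moves ex).
Proof.
(* With n keys, placing the sentinels costs at most 2(n + 2) + 8, which is at most 14n for positive
   n; reshaping costs 8 * 16n = 128n, and each cursor operation 8. *)
case=> k rap; exists (k * 142) => T lo hi qs ex bT lthi bnd mqs [vex _].
(* Without keys there are no queries; otherwise n is positive and absorbs the additive constant. *)
case eT: T => [|l x r].
  by case: qs mqs {vex} => //= y qs; rewrite eT.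
have fT : focus_key (T, [::]) by rewrite eT.
rewrite -eT; set S := bst_insert _ _.
have ltlo : all (ltn lo) (keys T) by apply: sub_all bnd => y /andP[].
have lthi' : all (ltn^~ hi) (keys T) by apply: sub_all bnd => y /andP[].
have eS : keys S = lo :: rcons (keys T) hi.
  by rewrite keys_insert_max keys_insert_min //= lthi.
have bS : bst S.
  rewrite /bst eS (sorted_pairwise ltn_trans) /= pairwise_rcons all_rcons /= lthi ltlo lthi'.
  by rewrite -(sorted_pairwise ltn_trans).
have n0 : 0 < size (keys T) by rewrite eT /= size_cat /= addnS.
have [|T1 [e1 s1]] := serves_sentinels _ eS bS; first by rewrite -size_eq0 -lt0n.
have b1 := serves_bst s1 bS.
have f1 : focus_key (T1, [::]) by move: n0; rewrite -e1; case: (T1).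
have s2 := reach_sim (reach_same_keys f1 fT e1) f1 b1.
have b2 := serves_bst s2 b1.
move: vex; rewrite /valid_exec; case ex': run_exec => [T'|] // _.
have [s [ms qss _ le]] := serves_trans (serves_trans s1 s2) (run_exec_sim fT b2 ex').
apply: leq_trans (rap S qs s bS ms qss) _; rewrite -mulnA leq_mul2l.
apply/orP; right; apply: leq_trans le _.
have sz : rotations ex + moves ex = size (flatten ex) := count_predC is_rot _.
rewrite e1 -[_ + rotations ex + _]addnA sz mulnDr leq_add ?leq_mul2r ?orbT //.
rewrite mulnA -[142]/(14 + 128) mulnDl leq_add2r; case: (size (keys T)) n0 => // n _.
by rewrite mulnS !(addSn, addnS) !ltnS addn0 add0n addnn -mul2n leq_mul2r orbT.
Qed.
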